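(* Let $G$ be a group and let $\mathcal{I}$ be an ideal on the ring $2^G$. Then $\{H\in 2^G: \zeta(G\setminus H)=G\setminus H\}$ forms a topology on $G$, where $\zeta(A)=A\cup A^{\propto}$ for $A\subseteq G$.
   Context: For a group $G$, $2^G$ denotes the power set of $G$, viewed as the ring $(2^G,\Delta,\cap)$ with $\Delta$ the symmetric difference as addition and $\cap$ as multiplication. An ideal $\mathcal{I}$ on $G$ (equivalently on $2^G$) is an ideal of this ring; equivalently, a nonempty family of subsets of $G$ closed under taking subsets and under finite unions. For $g\in G$ let $\mathcal{G}(g)$ be the set of all subgroups $K$ of $G$ with $g\in K$. For $A\subseteq G$, $A^{\propto}=A^{\propto}(\mathcal{I})=\{g\in G: K\cap A\notin\mathcal{I}\text{ for all }K\in\mathcal{G}(g)\}$. *)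

(* Defs.v *)
From HB Require Import structures.
From mathcomp Require Import all_boot all_classical.
From mathcomp Require Import topology_structure.

Set Implicit Arguments.
Unset Strict Implicit.
Unset Printing Implicit Defensive.

Local Open Scope classical_set_scope.

(* Ideals of the Boolean ring (set T, `+`, `&`), the improper ideal included.
   Closure under opposites is omitted, because - A = A in this ring. *)
Definition is_ideal (T : Type) (I : set (set T)) : Prop :=
  [/\ I set0,
      forall A B, I A -> I B -> I (A `+` B)
    & forall A B, I B -> I (A `&` B)].

Definition subgroups_at (G : groupType) (g : G) : set (set G) :=
  [set K : set G | group_closed (mem K) /\ K g].

Definition propto (G : groupType) (I : set (set G)) (A : set G) : set G :=
  [set g | forall K, subgroups_at g K -> ~ I (K `&` A)].

Definition zeta (G : groupType) (I : set (set G)) (A : set G) : set G :=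
  A `|` propto I A.

(* [Topological T] is the type of topological structures on the carrier [T], so
   this says that [tau] is exactly the family of open sets of one of them. *)
Definition is_topology (T : Type) (tau : set (set T)) : Prop :=
  exists X : Topological T, @open (Topological.Pack X) = tau.

(* Main.v *)
Require Import Defs.
From mathcomp Require Import all_boot all_classical.
From HB Require Import structures.
From mathcomp Require Import topology_structure.

Set Implicit Arguments.
Unset Strict Implicit.
Unset Printing Implicit Defensive.

Local Open Scope classical_set_scope.

(** A set [A] is fixed by [zeta I] exactly when [propto I A `<=` A], so such
    sets behave like the closed sets of a local function: [propto I] is
    monotone ([propto_subset]), which makes the fixed sets stable under
    arbitrary intersections; it kills the empty set ([propto0]); and it is
    subadditive on binary unions ([propto_setU]), which makes the fixed sets
    stable under binary unions. Taking complements gives the axioms of open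
    sets.

    All that matters about the subgroups containing a given [g] is that there
    is one, and that they are stable under binary intersection, so that they
    act as a base of neighbourhoods of [g]. The intersection is what gives
    subadditivity: if [K] witnesses that [g] is outside [propto I A] and [L]
    that it is outside [propto I B], then [K `&` L] witnesses that it is
    outside [propto I (A `|` B)]. *)

Lemma ideal_subset (T : Type) (I : set (set T)) (A B : set T) :
  is_ideal I -> A `<=` B -> I B -> I A.
Proof. by case=> _ _ idM /setIidl <-; exact: idM. Qed.

(** In the ring of subsets, a union is a sum once the two terms have been made
    disjoint, and [B `&` ~` A] is still a multiple of [B]. *)
Lemma ideal_setU (T : Type) (I : set (set T)) (A B : set T) :
  is_ideal I -> I A -> I B -> I (A `|` B).
Proof.
move=> idI IA IB; have [_ idD _] := idI.
have -> : A `|` B = A `+` (B `&` ~` A).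
  apply/seteqP; split=> x.
    have [Ax _|nAx [//|Bx]] := pselect (A x); first by left; split=> // -[].
    by right; split.
  by case=> [[Ax _]|[[Bx _] _]]; [left|right].
by apply: idD => //; apply: ideal_subset IB => // x [].
Qed.

Lemma subgroups_atI (G : groupType) (g : G) (K L : set G) :
  subgroups_at g K -> subgroups_at g L -> subgroups_at g (K `&` L).
Proof.
move=> [[K1 Kdiv] Kg] [[L1 Ldiv] Lg]; split; last by split.
split=> [|x y]; first by rewrite in_setI; apply/andP; split.
rewrite !in_setI => /andP[Kx Lx] /andP[Ky Ly].
by apply/andP; split; [exact: Kdiv|exact: Ldiv].
Qed.

Section Propto.
Variables (G : groupType) (I : set (set G)).
Hypothesis idI : is_ideal I.

(** The whole group contains every point, and meets the empty set in a member
    of the ideal. *)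
Lemma propto0 : propto I set0 = set0.
Proof.
rewrite -subset0 => g /(_ setT); apply.
  by split=> //; split=> [|x y _ _]; exact: in_setT.
by rewrite setI0; case: idI.
Qed.

Lemma propto_subset (A B : set G) : A `<=` B -> propto I A `<=` propto I B.
Proof.
move=> AB g gA K Kg IKB; apply: (gA K Kg).
by apply: ideal_subset IKB => //; exact: setIS.
Qed.

Lemma propto_setU (A B : set G) :
  propto I (A `|` B) `<=` propto I A `|` propto I B.
Proof.
move=> g gAB; apply: contrapT => /not_orP[].
move=> /existsNP[K /not_implyP[Kg /contrapT IKA]].
move=> /existsNP[L /not_implyP[Lg /contrapT ILB]].
apply: (gAB _ (subgroups_atI Kg Lg)).
apply: ideal_subset (ideal_setU idI IKA ILB) => //.
by move=> x [[Kx Lx] [Ax|Bx]]; [left|right].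
Qed.

Lemma zeta_fixP (A : set G) : zeta I A = A <-> propto I A `<=` A.
Proof. exact: setUidPl. Qed.

Lemma zeta_fix0 : zeta I set0 = set0.
Proof. by apply/zeta_fixP; rewrite propto0. Qed.

Lemma zeta_fix_setU (A B : set G) :
  zeta I A = A -> zeta I B = B -> zeta I (A `|` B) = A `|` B.
Proof.
move=> /zeta_fixP fA /zeta_fixP fB; apply/zeta_fixP.
by apply: subset_trans (propto_setU (B := B)) _; exact: setUSS.
Qed.

Lemma zeta_fix_bigcap (J : Type) (F : J -> set G) :
  (forall j, zeta I (F j) = F j) -> zeta I (\bigcap_j F j) = \bigcap_j F j.
Proof.
move=> fF; apply/zeta_fixP => g gF j _.
by apply: ((zeta_fixP _).1 (fF j)); apply: propto_subset gF => x; exact.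
Qed.

End Propto.

(** The carrier has to be a choice type because a topological structure
    contains a choice structure. *)
Lemma is_topology_open (T : choiceType) (tau : set (set T)) :
    tau setT -> setI_closed tau ->
    (forall (J : Type) (F : J -> set T),
      (forall j, tau (F j)) -> tau (\bigcup_j F j)) ->
  is_topology tau.
Proof.
move=> tauT tauI tauU.
pose X : topologicalType :=
  HB.pack T (@isOpenTopological.Axioms_ T _ _ tau tauT tauI tauU).
by exists (Topological.class X).
Qed.

Theorem corollary2p21 (G : groupType) (I : set (set G)) (hI : is_ideal I) :
  is_topology [set H : set G | zeta I (~` H) = ~` H].
Proof.
apply: is_topology_open => [|A B /= fA fB|J F fF] /=.
- by rewrite setCT; exact: zeta_fix0.
- by rewrite setCI; exact: zeta_fix_setU.
- by rewrite setC_bigcup; exact: zeta_fix_bigcap.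
Qed.
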